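(* Let $(\mu,\widetilde x)$ with $\|\widetilde x\|=1$ be an arbitrarily given approximation to the desired eigenpair $(\lambda_*,x_* )$ of $T(\lambda)x=0$, denote the corresponding residual norm by $\rho=\|T(\mu)\widetilde x\|$, and write $L(\mu)=X_\perp^HT(\mu)X_\perp$. If $\mu\in\mathcal{D}$, where $\mathcal{D}=\{\mu\in\Omega:\ |\mu-\lambda_*|\leq r\}\subset\Omega$ is a closed disc, and $\sigma_{\min}(L(\mu))>0$, then $$\sin\angle(\widetilde x,x_* )\leq\frac{\rho+\|T'(\lambda_* )\||\mu-\lambda_*|}{\sigma_{\min}(L(\mu))}+O(|\mu-\lambda_*|^2).$$
   Context: $\Omega\subseteq\mathbb{C}$ is a connected open set and $T:\Omega\to\mathbb{C}^{n\times n}$ is an analytic matrix-valued function that is regular, i.e. $\det T(\lambda)$ is not identically zero on $\Omega$. $(\lambda_*,x_* )$ is a simple eigenpair of $T$: $\lambda_*\in\Omega$ is a simple root of $\det T(\lambda)=0$, $T(\lambda_* )x_*=0$ and $\|x_*\|=1$. $\|\cdot\|$ is the 2-norm of a vector or matrix, $H$ denotes conjugate transpose, and $\sigma_{\min}$ is the smallest singular value. The columns of $X_\perp\in\mathbb{C}^{n\times(n-1)}$ form an orthonormal basis of the orthogonal complement of $\mathrm{span}\{x_*\}$ in $\mathbb{C}^n$, so that $(x_*\ X_\perp)$ is unitary. $\angle(\cdot,\cdot)$ is the acute angle between the lines spanned by two nonzero vectors. $O(\cdot)$ is understood as $\mu\to\lambda_*$. *)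

(* Defs.v *)
From HB Require Import structures.
From mathcomp Require Import all_boot all_order all_algebra.
From mathcomp Require Import sesquilinear spectral.
From mathcomp Require Import all_classical all_reals all_analysis.
From mathcomp Require Import complex.

Set Implicit Arguments.
Unset Strict Implicit.
Unset Printing Implicit Defensive.

Import Order.TTheory GRing.Theory Num.Theory.
Import numFieldNormedType.Exports.

Local Open Scope classical_set_scope.
Local Open Scope ring_scope.
Local Open Scope sesquilinear_scope.
Local Open Scope complex_scope.

(* The regular module [R[i]^o] is convertible to [R[i]] and carries the
   topology of the modulus [`|z|]; [R[i]] itself has no topological instance. *)
Definition analytic_on (R : realType) (V : normedModType R[i])
    (f : R[i]^o -> V) (U : set R[i]^o) : Prop :=
  forall z0, U z0 -> exists a : nat -> V,
    \forall z \near z0,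
      series (fun k : nat => ((z - z0) ^+ k : R[i]) *: a k) @ \oo --> f z.

Definition regular_on (R : realType) (n : nat)
    (T : R[i]^o -> 'M[R[i]]_n) (U : set R[i]^o) : Prop :=
  exists2 z, U z & \det (T z) != 0.

Definition simple_root (R : realType) (f : R[i]^o -> R[i]^o) (z : R[i]^o)
    : Prop :=
  f z = 0 /\ derive1 f z != 0.

Section Euclidean.
Variable R : realType.

(* The real modulus [Re `|z|]: in the library [`|z|] is an element of [R[i]]. *)
Definition cmod (z : R[i]) : R := complex.Re `|z|.

Definition norm2 (n : nat) (x : 'cV[R[i]]_n) : R :=
  Num.sqrt (\sum_(i < n) cmod (x i 0) ^+ 2).

Definition mxnorm2 (m n : nat) (A : 'M[R[i]]_(m, n)) : R :=
  sup [set norm2 (A *m x) | x in [set x : 'cV[R[i]]_n | norm2 x = 1]].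

Definition singular_values (n : nat) (A : 'M[R[i]]_n) : set R :=
  [set s | 0 <= s /\ eigenvalue (A^t* *m A) ((s ^+ 2)%:C)].

(* A minimum as soon as [n > 0]; for the 0 x 0 matrix there is no singular value
   and [inf set0 = 0]. *)
Definition sigma_min (n : nat) (A : 'M[R[i]]_n) : R := inf (singular_values A).

Definition cdot (n : nat) (x y : 'cV[R[i]]_n) : R[i] := (x^t* *m y) 0 0.

(* The argument of [acos] is in [0, 1], so the angle is the acute one. *)
Definition line_angle (n : nat) (x y : 'cV[R[i]]_n) : R :=
  acos (cmod (cdot x y) / (norm2 x * norm2 y)).

(* The columns of [X] are orthonormal and span the orthogonal complement of
   [x]. *)
Definition orthonormal_basis_compl (n k : nat) (x : 'cV[R[i]]_n)
    (X : 'M[R[i]]_(n, k)) : Prop :=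
  X^t* *m X = 1%:M /\
  forall v : 'cV[R[i]]_n, cdot x v = 0 <-> exists c : 'cV[R[i]]_k, v = X *m c.

End Euclidean.

Definition closed_disc (R : realType) (z0 : R[i]^o) (r : R) : set R[i]^o :=
  [set z | cmod (z - z0) <= r].

(* Main.v *)
(** With [s = |Xp^* xt|] the sine and [c = |x^* xt|] the cosine of the angle,
    splitting [xt] along [x] and the columns of [Xp] gives
    [sigma s <= rho + |T(mu) x| c], where [sigma] is the least singular value of
    [L(mu)] and, by Taylor expansion at [lam],
    [|T(mu) x| <= |T'(lam)| |mu - lam| + O(|mu - lam|^2)].
    If [L(lam)] is invertible, [sigma] is bounded below near [lam], so the
    quadratic term stays quadratic after division by [sigma].  A simple root does
    not force [L(lam)] to be invertible; if it is singular, [sigma] is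
    [O(|mu - lam|)], and the bound holds near [lam] with no error term at all
    since [T'(lam) <> 0]. *)

Require Import Defs.
From HB Require Import structures.
From mathcomp Require Import all_boot all_order all_algebra.
From mathcomp Require Import sesquilinear spectral.
From mathcomp Require Import all_classical all_reals all_analysis.
From mathcomp Require Import complex.
From mathcomp Require Import perm ring lra.

Set Implicit Arguments.
Unset Strict Implicit.
Unset Printing Implicit Defensive.

Import Order.TTheory GRing.Theory Num.Theory.
Import numFieldNormedType.Exports.

Local Open Scope classical_set_scope.
Local Open Scope ring_scope.
Local Open Scope sesquilinear_scope.

(** * Complex modulus, Euclidean norm and bounds on matrix-vector products *)

Section EuclideanNorm.
Variable R : realType.
Implicit Types (z : R[i]) (n : nat).

Lemma cmodE z : (cmod z)%:C%C = `|z|.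
Proof. by rewrite /cmod; apply: RRe_real; apply: normr_real. Qed.

Lemma cmod_ge0 z : 0 <= cmod z.
Proof. by rewrite -ler0c cmodE. Qed.

Lemma cmod_le z (a : R) : (cmod z <= a) = (`|z| <= a%:C%C).
Proof. by rewrite -cmodE lecR. Qed.

Lemma cmodM z1 z2 : cmod (z1 * z2) = cmod z1 * cmod z2.
Proof. by apply: (@complexI R); rewrite rmorphM /= !cmodE normrM. Qed.

Lemma cmodD z1 z2 : cmod (z1 + z2) <= cmod z1 + cmod z2.
Proof. by rewrite -lecR rmorphD /= !cmodE ler_normD. Qed.

Lemma cmod0 : cmod (0 : R[i]) = 0.
Proof. by rewrite /cmod normr0. Qed.

Lemma cmod_eq0 z : (cmod z == 0) = (z == 0).
Proof. by rewrite -(inj_eq (@complexI R)) cmodE normr_eq0. Qed.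

Lemma cmod_sum (I : Type) (s : seq I) (F : I -> R[i]) :
  cmod (\sum_(i <- s) F i) <= \sum_(i <- s) cmod (F i).
Proof.
elim/big_ind2 : _ => [|a b c d ab cd|//]; first by rewrite cmod0.
exact: le_trans (cmodD _ _) (lerD ab cd).
Qed.

Lemma cmod_prod (I : finType) (F : I -> R[i]) :
  cmod (\prod_i F i) = \prod_i cmod (F i).
Proof.
elim/big_ind2 : _ => [|a b c d <- <-|//]; last by rewrite cmodM.
by rewrite /cmod normr1.
Qed.

Lemma norm2_ge0 n (v : 'cV[R[i]]_n) : 0 <= norm2 v.
Proof. exact: sqrtr_ge0. Qed.

Lemma sqr_norm2 n (v : 'cV[R[i]]_n) :
  norm2 v ^+ 2 = \sum_(i < n) cmod (v i 0) ^+ 2.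
Proof. by rewrite sqr_sqrtr // sumr_ge0 // => i _; rewrite sqr_ge0. Qed.

Lemma norm2_dot n (v : 'cV[R[i]]_n) :
  (norm2 v ^+ 2)%:C%C = (v^t* *m v) 0 0.
Proof.
rewrite sqr_norm2 rmorph_sum /= mxE; apply: eq_bigr => i _.
by rewrite rmorphXn /= cmodE normCKC !mxE.
Qed.

(** Identifies [norm2] with the norm of the form [dotmx] on rows, whose triangle inequality then
    gives [norm2D]. *)
Lemma norm2_dotmx n (v : 'cV[R[i]]_n) :
  (norm2 v)%:C%C = sqrtC (dotmx v^T v^T).
Proof.
suff -> : dotmx v^T v^T = (norm2 v)%:C%C ^+ 2.
  by rewrite sqrCK // ler0c norm2_ge0.
rewrite -rmorphXn /= sqr_norm2 rmorph_sum /= dotmxE mxE.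
by apply: eq_bigr => i _; rewrite rmorphXn /= cmodE normCK !mxE.
Qed.

Lemma norm2D n (u v : 'cV[R[i]]_n) : norm2 (u + v) <= norm2 u + norm2 v.
Proof.
rewrite -lecR rmorphD /= !norm2_dotmx linearD /=.
exact: (triangle_lerif (@dotmx R[i] n) u^T v^T).
Qed.

Lemma norm2Z n a (v : 'cV[R[i]]_n) : norm2 (a *: v) = cmod a * norm2 v.
Proof.
apply/eqP; rewrite -(eqrXn2 (n := 2)) ?norm2_ge0 ?mulr_ge0 ?cmod_ge0//;
  last exact: norm2_ge0.
rewrite exprMn !sqr_norm2 mulr_sumr; apply/eqP/eq_bigr => i _.
by rewrite mxE cmodM exprMn.
Qed.

Lemma norm2N n (v : 'cV[R[i]]_n) : norm2 (- v) = norm2 v.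
Proof. by rewrite -scaleN1r norm2Z /cmod normrN normr1 mul1r. Qed.

Lemma norm2_eq0 n (v : 'cV[R[i]]_n) : (norm2 v == 0) = (v == 0).
Proof.
rewrite -sqrf_eq0 sqr_norm2 psumr_eq0 => [|i _];
  last exact: sqr_ge0.
apply/allP/eqP => [v0|-> i _]; last by rewrite mxE cmod0 expr0n eqxx.
apply/colP => i; rewrite mxE; apply/eqP.
by have := v0 i (mem_index_enum i); rewrite expf_eq0 /= cmod_eq0.
Qed.

Lemma cmod_le_norm2 n (v : 'cV[R[i]]_n) i : cmod (v i 0) <= norm2 v.
Proof.
rewrite -(ler_pXn2r (n := 2)) ?nnegrE ?cmod_ge0 ?norm2_ge0 //.
rewrite sqr_norm2 (bigD1 i) //= lerDl sumr_ge0 // => j _; exact: sqr_ge0.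
Qed.

Lemma norm2_le_sum n (v : 'cV[R[i]]_n) : norm2 v <= \sum_i cmod (v i 0).
Proof.
have s0 : 0 <= \sum_i cmod (v i 0) by rewrite sumr_ge0 // => i _; exact: cmod_ge0.
rewrite -(ler_pXn2r (n := 2)) ?nnegrE ?norm2_ge0 //.
rewrite sqr_norm2 [leRHS]expr2 mulr_suml; apply: ler_sum => i _.
rewrite expr2 ler_wpM2l ?cmod_ge0 // (bigD1 i) //= lerDl.
by rewrite sumr_ge0 // => j _; exact: cmod_ge0.
Qed.

(** A crude bound through the sum of the moduli; it serves only where the size of the constant is
    irrelevant. *)
Lemma norm2_mulmx_le m n (A : 'M[R[i]]_(m, n)) (e : R) (v : 'cV[R[i]]_n) :
  (forall i j, cmod (A i j) <= e) ->
  norm2 (A *m v) <= (m * n)%:R * e * norm2 v.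
Proof.
move=> Ae; apply: le_trans (norm2_le_sum _) _.
have -> : (m * n)%:R * e * norm2 v = \sum_(i < m) \sum_(j < n) e * norm2 v.
  by rewrite !sumr_const !card_ord -mulrnA -mulrA mulr_natl mulnC.
apply: ler_sum => i _; rewrite mxE; apply: le_trans (cmod_sum _ _) _.
apply: ler_sum => j _; rewrite cmodM ler_pM ?cmod_ge0 //.
exact: cmod_le_norm2.
Qed.

(** Makes the set behind [mxnorm2] bounded above, and later bounds the inverse of the compressed
    matrix at [lam]. *)
Lemma mulmx_bounded m n (A : 'M[R[i]]_(m, n)) :
  exists2 M : R, 0 < M & forall v, norm2 (A *m v) <= M * norm2 v.
Proof.
pose e := \sum_i \sum_j cmod (A i j).
have Ae i j : cmod (A i j) <= e.
  rewrite /e (bigD1 i) //= (bigD1 j) //= -addrA lerDl addr_ge0 //.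
    by rewrite sumr_ge0 // => k _; exact: cmod_ge0.
  by rewrite sumr_ge0 // => k _; rewrite sumr_ge0 // => l _; exact: cmod_ge0.
have e0 : 0 <= e.
  by rewrite sumr_ge0 // => k _; rewrite sumr_ge0 // => l _; exact: cmod_ge0.
exists ((m * n)%:R * e + 1) => [|v]; first by rewrite ltr_wpDl // mulr_ge0.
apply: le_trans (norm2_mulmx_le v Ae) _.
by rewrite ler_wpM2r ?norm2_ge0 // lerDl.
Qed.

Lemma mxnorm2_ge0 m n (A : 'M[R[i]]_(m, n)) : 0 <= mxnorm2 A.
Proof.
rewrite /mxnorm2; set S := [set _ | _ in _].
(* For [n = 0] there is no unit vector, and the supremum of the empty set is 0. *)
have [[_ [v v1 _]]|S0] := pselect (S !=set0); last first.
  by rewrite (_ : S = set0) ?sup0 //; apply/eqP/negP => /negP/set0P.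
apply: le_trans (norm2_ge0 (A *m v)) _; apply: ub_le_sup; last by exists v.
have [M _ AM] := mulmx_bounded A.
by exists M => _ [w w1 <-]; have := AM w; rewrite w1 mulr1.
Qed.

Lemma norm2_mulmx m n (A : 'M[R[i]]_(m, n)) v :
  norm2 (A *m v) <= mxnorm2 A * norm2 v.
Proof.
have [->|v0] := eqVneq v 0.
  have /eqP -> : norm2 (0 : 'cV[R[i]]_n) == 0 by rewrite norm2_eq0.
  by rewrite mulmx0 mulr0 le_eqVlt norm2_eq0 eqxx.
have nv : 0 < norm2 v by rewrite lt_neqAle eq_sym norm2_eq0 v0 norm2_ge0.
pose w := (norm2 v)^-1%:C%C *: v.
have cV : cmod (norm2 v)^-1%:C%C = (norm2 v)^-1.
  by rewrite /cmod ger0_norm // ler0c invr_ge0 ltW.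
have w1 : norm2 w = 1 by rewrite norm2Z cV mulVf // gt_eqF.
rewrite -ler_pdivrMr // mulrC -cV -norm2Z scalemxAr.
apply: ub_le_sup; last by exists w.
have [M _ AM] := mulmx_bounded A.
by exists M => _ [u u1 <-]; have := AM u; rewrite u1 mulr1.
Qed.

End EuclideanNorm.

(** * The least singular value as the best lower bound of a matrix *)

Section SingularValues.
Variable R : realType.

Lemma singular_values_ge0 n (A : 'M[R[i]]_n) : lbound (singular_values A) 0.
Proof. by move=> s []. Qed.

(** Unitary diagonalisation of [A^t* *m A] writes [norm2 (A *m v) ^+ 2] as a sum of squared
    coordinates of [P *m v] weighted by squares of singular values, and [P] preserves the norm. *)
Lemma sigma_min_le n (A : 'M[R[i]]_n) v :
  sigma_min A * norm2 v <= norm2 (A *m v).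
Proof.
have [s0|s0] := lerP (sigma_min A) 0.
  by apply: le_trans (norm2_ge0 _); rewrite mulr_le0_ge0 ?norm2_ge0.
pose G := A^t* *m A; pose P := spectralmx G; pose D := spectral_diag G.
have GH : G^t* = G by rewrite /G trmx_mul map_mxM /= trmxCK.
have Pu : P \is unitarymx := spectral_unitarymx G.
have GE : G = P^t* *m diag_mx D *m P.
  rewrite -invmx_unitary //; apply/orthomx_spectralP.
  by apply/normalmxP; rewrite GH.
have PP : P *m P^t* = 1%:M by apply/unitarymxP.
have PP' : P^t* *m P = 1%:M by apply: mulmx1C.
have dotG u : (norm2 (A *m u) ^+ 2)%:C%C = (u^t* *m G *m u) 0 0.
  by rewrite norm2_dot trmx_mul map_mxM !mulmxA.
have quadE u : (u^t* *m G *m u) 0 0 = \sum_j D 0 j * `|(P *m u) j 0| ^+ 2.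
  have -> : u^t* *m G *m u = (P *m u)^t* *m (diag_mx D *m (P *m u)).
    by rewrite GE trmx_mul map_mxM !mulmxA.
  rewrite mxE; apply: eq_bigr => j _.
  by rewrite mul_diag_mx !mxE mulrCA normCKC.
(* [P^t* *m delta_mx j 0] is a unit eigenvector of [G] for [D 0 j], so [sv j] is the real square
   root of that eigenvalue. *)
pose sv j := norm2 (A *m (P^t* *m delta_mx j 0)).
have svE j : (sv j ^+ 2)%:C%C = D 0 j.
  rewrite dotG quadE mulmxA PP mul1mx (bigD1 j) //= big1 ?addr0 => [|k kj].
    by rewrite mxE !eqxx normr1 expr1n mulr1.
  by rewrite mxE (negbTE kj) normr0 expr0n mulr0.
have svS j : singular_values A (sv j).
  split; first exact: norm2_ge0.
  apply/eigenvalueP; exists (row j P).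
    rewrite -[_ *m A]/G GE svE -row_mul !mulmxA PP mul1mx.
    by rewrite row_mul row_diag_mx -scalemxAl -rowE.
  apply/negP => /eqP /(congr1 (mulmx^~ (P^t*))).
  rewrite mul0mx -row_mul PP => /rowP /(_ j); rewrite !mxE eqxx.
  by move/eqP; rewrite oner_eq0.
have svge j : sigma_min A <= sv j.
  by apply: ge_inf => //; exists 0; exact: singular_values_ge0.
have vP : norm2 v = norm2 (P *m v).
  apply/eqP; rewrite -(eqrXn2 (n := 2)) ?norm2_ge0 //; apply/eqP.
  apply: (@complexI R); rewrite !norm2_dot trmx_mul map_mxM /=.
  by rewrite -!mulmxA [P^t* *m _]mulmxA PP' mul1mx.
rewrite -(ler_pXn2r (n := 2)) ?nnegrE ?mulr_ge0 ?norm2_ge0 ?(ltW s0) //.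
rewrite vP -lecR dotG quadE exprMn sqr_norm2 mulr_sumr rmorph_sum /=.
apply: ler_sum => j _; rewrite rmorphM !rmorphXn /= cmodE.
rewrite -svE ler_wpM2r ?exprn_ge0 // -!rmorphXn lecR.
by rewrite ler_pXn2r ?nnegrE ?norm2_ge0 ?(ltW s0).
Qed.

(** An eigenvector of [A^t* *m A] for [s ^+ 2] is stretched by [A] exactly by [s]. Positivity of
    [sigma_min A] excludes an empty set of singular values, whose infimum would be 0. *)
Lemma le_sigma_min n (A : 'M[R[i]]_n) (c : R) :
  0 < sigma_min A -> 0 <= c ->
  (forall v, c * norm2 v <= norm2 (A *m v)) -> c <= sigma_min A.
Proof.
move=> s0 c0 cA; apply: lb_le_inf => [|s [s_ge0 /eigenvalueP[u uG u0]]].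
  apply/set0P/negP => /eqP S0.
  by move: s0; rewrite /sigma_min S0 inf0 ltxx.
have un : 0 < norm2 (u^t*).
  rewrite lt_neqAle norm2_ge0 andbT eq_sym norm2_eq0.
  apply: contra u0 => /eqP /(congr1 (fun X => X^t*)).
  by rewrite trmxCK trmx0 map_mx0 => ->.
rewrite -(ler_pM2r un); apply: le_trans (cA _) _.
rewrite -(ler_pXn2r (n := 2)) ?nnegrE ?mulr_ge0 ?norm2_ge0 //.
rewrite -lecR exprMn [leRHS]rmorphM /= !norm2_dot trmx_mul map_mxM /= trmxCK.
by rewrite mulmxA -[u *m _ *m _]mulmxA uG -scalemxAl mxE.
Qed.

End SingularValues.

(** * Quadratic remainder of a power series and the derivative it determines *)

Section PowerSeries.
Variables (K : numFieldType) (V : normedModType K).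
Implicit Types (f : K^o -> V) (a : nat -> V) (z : K^o).

(* Geometric domination from the bounded partial sums at one point [z0 + w]. *)
Lemma power_series_quadratic_remainder f a z0 :
  (\forall z \near z0,
    series (fun k : nat => ((z - z0) ^+ k : K) *: a k) @ \oo --> f z) ->
  exists2 C : K, 0 <= C & exists2 d : K, 0 < d &
    forall z, `|z - z0| < d ->
      `|f z - f z0 - ((z - z0) : K) *: a 1%N| <= C * `|z - z0| ^+ 2.
Proof.
move=> /nbhs_ballP[e /= e0 sumf].
have [w w0 we] : exists2 w, 0 < w & w < e.
  by exists (e / 2); rewrite ?divr_gt0 // ltr_pdivrMr // mulr_natr mulr2n ltrDl.
have [M M0 bndM] : exists2 M : K, 0 < M &
    forall k, `|series (fun k : nat => ((z0 + w - z0) ^+ k : K) *: a k) k| < M.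
  have /cvgP/cvg_seq_bounded/ex_strict_bound_gt0[M M0 /= bndM] :
      series (fun k : nat => ((z0 + w - z0) ^+ k : K) *: a k) @ \oo
        --> f (z0 + w).
    apply: sumf; rewrite -ball_normE /ball_ /= opprD addrA subrr sub0r normrN.
    by rewrite gtr0_norm.
  by exists M => // k; exact: bndM.
(* Each term at [z0 + w] is the difference of two consecutive partial sums, both below [M]. *)
have bnd k : `|a k| <= 2 * M / w ^+ k.
  rewrite ler_pdivlMr ?exprn_gt0 // mulrC -{1}(gtr0_norm w0) -normrX -normrZ.
  have := bndM k.+1; have := bndM k; rewrite !seriesEnat /= big_nat_recr //=.
  rewrite addrAC subrr add0r; set s := \sum_(_ <= _ < _) _ => sk sk1.
  rewrite -[X in `|X|](addKr s) mulr_natl mulr2n; apply: le_trans (ler_normD _ _) _.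
  by rewrite normrN lerD // ltW.
have geo (m u t : K) :
    4 * m * u * (1 - 2^-1 * t) = 4 * m * u * (1 - t) + 2 * m * u * t.
  by field.
have main z : `|z - z0| < w / 2 ->
    `|f z - a 0%N - ((z - z0) : K) *: a 1%N| <= 4 * M / w ^+ 2 * `|z - z0| ^+ 2.
  move=> zw; set h := z - z0; pose q : K := `|h| / w.
  have q0 : 0 <= q by rewrite divr_ge0 // ltW.
  have q12 : q <= 2^-1.
    by rewrite ler_pdivrMr // [_ * w]mulrC ltW.
  have -> : 4 * M / w ^+ 2 * `|h| ^+ 2 = 4 * M * q ^+ 2.
    by rewrite [q ^+ 2]expr_div_n -[LHS]mulrA; congr (_ * _); exact: mulrC.
  (* With [q <= 1/2], the term of order [k >= 2] is at most [2 * M * q ^+ 2 * 2^-1 ^+ (k - 2)];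
     these bounds sum to the right-hand side. *)
  have part N : `|series (fun k : nat => (h ^+ k : K) *: a k) N.+2
                  - a 0%N - (h : K) *: a 1%N| <= 4 * M * q ^+ 2 * (1 - 2^-1 ^+ N).
    elim: N => [|N IH].
      rewrite seriesEnat /= !big_nat_recr //= big_geq // add0r expr0 expr1 scale1r.
      by rewrite addrAC addrK !subrr normr0 mulr0.
    have -> : 4 * M * q ^+ 2 * (1 - 2^-1 ^+ N.+1)
        = 4 * M * q ^+ 2 * (1 - 2^-1 ^+ N) + 2 * M * q ^+ 2 * 2^-1 ^+ N.
      by rewrite [_ ^+ N.+1]exprS geo.
    rewrite seriesEnat /= big_nat_recr //= -/(series _ N.+2).
    rewrite -!addrA [_ *: _ + _]addrC !addrA.
    apply: le_trans (ler_normD _ _) _; apply: lerD; first exact: IH.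
    rewrite normrZ normrX; apply: le_trans (ler_wpM2l _ (bnd _)) _.
      by rewrite exprn_ge0.
    rewrite mulrCA -expr_div_n -/q -[leRHS]mulrA ler_wpM2l ?mulr_ge0 ?(ltW M0) //.
    rewrite -(addn2 N) exprD [leLHS]mulrC ler_wpM2l ?exprn_ge0 //.
    by rewrite lerXn2r ?nnegrE // invr_ge0.
  apply/ler_addgt0Pr => eps eps0.
  have /cvgrPdist_lt/(_ eps eps0)[N _ HN] :
      series (fun k : nat => (h ^+ k : K) *: a k) @ \oo --> f z.
    apply: sumf; rewrite -ball_normE /ball_ /= distrC.
    apply: lt_trans zw _; apply: lt_trans _ we.
    by rewrite ltr_pdivrMr // mulr_natr mulr2n ltrDl.
  have {}HN := HN N.+2 (leq_trans (leqnSn _) (leqnSn _)).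
  set S := series _ N.+2 in HN; have := part N; rewrite -/S => SN.
  have -> : f z - a 0%N - (h : K) *: a 1%N
      = S - a 0%N - (h : K) *: a 1%N + (f z - S).
    by rewrite [RHS]addrC !addrA subrK.
  apply: le_trans (ler_normD _ _) _.
  apply: lerD; last exact: ltW.
  apply: le_trans SN _.
  apply: ler_piMr; last by rewrite gerBl exprn_ge0 // invr_ge0.
  by apply: mulr_ge0; [rewrite mulr_ge0 // ltW|exact: exprn_ge0].
exists (4 * M / w ^+ 2); first by rewrite divr_ge0 ?exprn_ge0 ?mulr_ge0 ?ltW.
exists (w / 2); first by rewrite divr_gt0.
(* At [z = z0] the bound is 0, which forces [a 0 = f z0]. *)
have /eqP fz0 : f z0 - a 0%N == 0.
  rewrite -normr_le0; have := main z0.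
  by rewrite subrr normr0 expr0n /= mulr0 scale0r subr0; apply; rewrite divr_gt0.
by move=> z zd; rewrite (subr0_eq fz0); apply: main.
Qed.

(** The difference quotient with step [h] is within [C * |h|] of [v]. This identifies the linear
    coefficient of the series, and later shows that a quadratically small determinant has derivative
    0. *)
Lemma derive1_quadratic_remainder f z0 (v : V) (C d : K) :
  0 < d ->
  (forall z, `|z - z0| < d ->
      `|f z - f z0 - ((z - z0) : K) *: v| <= C * `|z - z0| ^+ 2) ->
  derive1 f z0 = v.
Proof.
move=> d0 fC; apply: cvg_lim => //; apply/cvgrPdist_le => eps eps0.
(* The sign of [C] is read off from the hypothesis at [z0 + d / 2]. *)
have C0 : 0 <= C.
  have := fC (z0 + d / 2); rewrite addrAC subrr add0r gtr0_norm ?divr_gt0 //.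
  rewrite ltr_pdivrMr // mulr_natr mulr2n ltrDl => /(_ d0) /(le_trans (normr_ge0 _)).
  by rewrite pmulr_lge0 // exprn_gt0 // divr_gt0.
have C1 : 0 < C + 1 by rewrite ltr_wpDl.
pose d' := eps / (C + 1).
have d'0 : 0 < d' by rewrite divr_gt0.
apply: filterS2 (dnbhs_ball (0 : K^o) d0) (dnbhs_ball (0 : K^o) d'0) => h.
rewrite -!ball_normE /ball_ /= !sub0r !normrN => -[hd /eqP h0] [hd' _].
have hz : h + z0 - z0 = h by rewrite addrK.
have := fC (h + z0); rewrite hz => /(_ hd) fh.
have -> : v - h^-1 *: (f (h + z0) - f z0)
    = - (h^-1 *: (f (h + z0) - f z0 - (h : K) *: v)).
  by rewrite [in RHS]scalerBr scalerA mulVf // scale1r opprB.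
rewrite normrN normrZ normfV mulrC ler_pdivrMr ?normr_gt0 //.
apply: le_trans fh _; rewrite expr2 mulrA ler_wpM2r //.
apply: le_trans (_ : (C + 1) * `|h| <= _); first by rewrite ler_wpM2r // lerDl.
by rewrite mulrC -ler_pdivlMr // ltW.
Qed.

End PowerSeries.

(** * Entrywise Taylor remainder and determinant bounds *)

Section MatrixBounds.
Variable R : realType.

Lemma normr_entry_le (K : numDomainType) m n (A : 'M[K]_(m, n)) i j :
  `|A i j| <= `|A|.
Proof.
rewrite [leRHS]/Num.Def.normr /= mx_normE -[leLHS]nngE num_le.
exact: (le_bigmax _ (fun i : 'I_m * 'I_n => `|A i.1 i.2|%:nng) (i, j)).
Qed.

Lemma analytic_remainder m n (T : R[i]^o -> 'M[R[i]]_(m, n)) U z0 :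
  analytic_on T U -> U z0 ->
  exists2 C : R, 0 <= C & exists2 d : R, 0 < d &
    forall z, cmod (z - z0) < d -> forall i j,
      cmod ((T z - T z0 - ((z - z0) : R[i]) *: derive1 T z0) i j)
        <= C * cmod (z - z0) ^+ 2.
Proof.
move=> anT /anT[a /power_series_quadratic_remainder[C C0 [d d0 TC]]].
rewrite (derive1_quadratic_remainder d0 TC).
(* Elements of [R[i]] comparable with 0 are real, so taking real parts does not change the
   constants. *)
have CE : (complex.Re C)%:C%C = C by apply/RRe_real/ger0_real.
have dE : (complex.Re d)%:C%C = d by apply/RRe_real/gtr0_real.
exists (complex.Re C); first by rewrite -ler0c CE.
exists (complex.Re d) => [|z]; first by rewrite -ltcR dE.
rewrite -ltcR cmodE dE => /TC zC i j.
rewrite cmod_le rmorphM rmorphXn /= cmodE CE.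
exact: le_trans (normr_entry_le _ _ _) zC.
Qed.

Lemma cmod_sign (k : nat) : cmod ((-1) ^+ k : R[i]) = 1.
Proof. by apply: (@complexI R); rewrite cmodE normrX normrN normr1 expr1n. Qed.

Lemma cmod_det_le n (A : 'M[R[i]]_n) (M : R) :
  (forall i j, cmod (A i j) <= M) -> cmod (\det A) <= n`!%:R * M ^+ n.
Proof.
move=> AM; apply: le_trans (cmod_sum _ _) _.
have -> : n`!%:R * M ^+ n = \sum_(s : 'S_n) M ^+ n.
  by rewrite sumr_const card_Sn mulr_natl.
apply: ler_sum => s _; rewrite cmodM cmod_prod.
rewrite cmod_sign mul1r -[n in M ^+ n]card_ord -prodr_const.
by apply: ler_prod => i _; rewrite cmod_ge0 AM.
Qed.

(** Multiply [A *m v] by the adjugate: its entries are cofactors, bounded uniformly by the Leibniz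
    formula. A unit vector that [A] nearly annihilates thus forces a small determinant. *)
Lemma det_mul_norm2_le n (M : R) : 0 <= M -> exists2 K : R, 0 < K &
  forall (A : 'M[R[i]]_n) v, (forall i j, cmod (A i j) <= M) ->
    cmod (\det A) * norm2 v <= K * norm2 (A *m v).
Proof.
move=> M0; exists ((n * n)%:R * (n.-1`!%:R * M ^+ n.-1) + 1) => [|A v AM].
  by rewrite ltr_wpDl // !mulr_ge0 ?exprn_ge0.
rewrite -norm2Z -mul_scalar_mx -mul_adj_mx -mulmxA.
apply: le_trans (_ : (n * n)%:R * (n.-1`!%:R * M ^+ n.-1) * norm2 (A *m v) <= _).
  apply: norm2_mulmx_le => i j; rewrite mxE /cofactor cmodM.
  by rewrite cmod_sign mul1r; apply: cmod_det_le => k l; rewrite !mxE.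
by rewrite ler_wpM2r ?norm2_ge0 // lerDl.
Qed.

End MatrixBounds.

(** * Splitting along the eigenvector and its orthogonal complement *)

Section OrthogonalSplitting.
Variables (R : realType) (n k : nat) (x : 'cV[R[i]]_n) (X : 'M[R[i]]_(n, k)).
Hypotheses (x1 : norm2 x = 1) (xX : orthonormal_basis_compl x X).

Lemma cdotxx : x^t* *m x = 1%:M.
Proof.
by apply/matrixP => i j; rewrite !ord1 -norm2_dot x1 expr1n mxE eqxx.
Qed.

Lemma compl_ortho : x^t* *m X = 0.
Proof.
apply/rowP => j; rewrite [RHS]mxE.
have := (xX.2 (X *m delta_mx j 0)).2 (ex_intro _ _ erefl).
by rewrite /cdot mulmxA -colE mxE.
Qed.

Lemma compl_ortho_tr : X^t* *m x = 0.
Proof.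
have := congr1 (fun A => A^t*) compl_ortho.
by rewrite trmx_mul map_mxM /= trmxCK trmx0 map_mx0.
Qed.

Lemma compl_decomp v : v = cdot x v *: x + X *m (X^t* *m v).
Proof.
have [|c vE] := (xX.2 (v - cdot x v *: x)).1 _.
  rewrite /cdot mulmxBr -scalemxAr cdotxx.
  by rewrite [LHS]mxE [X in _ + X]mxE !mxE eqxx mulr1 subrr.
have -> : X^t* *m v = c.
  have := congr1 (mulmx (X^t*)) vE.
  by rewrite mulmxBr -scalemxAr compl_ortho_tr scaler0 subr0 mulmxA xX.1 mul1mx.
by rewrite -vE addrC subrK.
Qed.

Lemma norm2_pythagoras v :
  norm2 v ^+ 2 = cmod (cdot x v) ^+ 2 + norm2 (X^t* *m v) ^+ 2.
Proof.
(* Only the second factor of [v^t* *m v] is decomposed; its two components then pair with [v^t*] to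
   give the two squares. *)
apply: (@complexI R); rewrite rmorphD /= !norm2_dot {2}(compl_decomp v).
rewrite mulmxDr -scalemxAr mxE [in LHS]mxE; congr (_ + _).
  rewrite rmorphXn /= cmodE normCK; congr (_ * _).
  by rewrite /cdot !mxE rmorph_sum; apply: eq_bigr => i _;
     rewrite !mxE rmorphM /= conjCK mulrC.
by rewrite trmx_mul map_mxM /= trmxCK !mulmxA.
Qed.

Lemma norm2_compl_le v : norm2 (X^t* *m v) <= norm2 v.
Proof.
rewrite -(ler_pXn2r (n := 2)) ?nnegrE ?norm2_ge0 //.
by rewrite norm2_pythagoras lerDr sqr_ge0.
Qed.

Lemma norm2_compl_emb c : norm2 (X *m c) = norm2 c.
Proof.
apply/eqP; rewrite -(eqrXn2 (n := 2)) ?norm2_ge0 //; apply/eqP.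
apply: (@complexI R); rewrite !norm2_dot trmx_mul map_mxM /=.
by rewrite -!mulmxA [X^t* *m _]mulmxA xX.1 mul1mx.
Qed.

Lemma sin_line_angle v : norm2 v = 1 ->
  sin (line_angle v x) = norm2 (X^t* *m v).
Proof.
move=> v1; rewrite /line_angle v1 x1 mulr1 divr1.
have -> : cmod (cdot v x) = cmod (cdot x v).
  apply: (@complexI R); rewrite !cmodE -[LHS]norm_conjC; congr `|_|.
  by rewrite /cdot !mxE rmorph_sum; apply: eq_bigr => i _;
     rewrite !mxE rmorphM /= conjCK mulrC.
have := norm2_pythagoras v; rewrite v1 expr1n => E.
rewrite sin_acos.
  by rewrite E addrAC subrr add0r sqrtr_sqr ger0_norm ?norm2_ge0.
rewrite (le_trans _ (cmod_ge0 _)) ?lerN10 //=.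
rewrite -(ler_pXn2r (n := 2)) ?nnegrE ?cmod_ge0 //.
by rewrite expr1n E lerDl sqr_ge0.
Qed.

(** Apply [X^t* *m A] to the splitting of [v] and solve for the [X] component; [X^t*] does not
    increase norms. The cosine factor is kept, since the singular case depends on it. *)
Lemma residual_bound (A : 'M[R[i]]_n) v :
  sigma_min (X^t* *m A *m X) * norm2 (X^t* *m v)
    <= norm2 (A *m v) + norm2 (A *m x) * cmod (cdot x v).
Proof.
apply: le_trans (sigma_min_le _ _) _.
have -> : X^t* *m A *m X *m (X^t* *m v)
    = X^t* *m (A *m v) - cdot x v *: (X^t* *m (A *m x)).
  rewrite {2}(compl_decomp v) mulmxDr mulmxDr -!scalemxAr addrAC subrr add0r.
  by rewrite !mulmxA.
apply: le_trans (norm2D _ _) _; rewrite norm2N norm2Z.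
by rewrite lerD ?norm2_compl_le // mulrC ler_wpM2r ?cmod_ge0 // norm2_compl_le.
Qed.

End OrthogonalSplitting.

(** * First-order behaviour of [T] at the eigenvalue *)

Section LocalEstimate.
Variable R : realType.

(** The linear term carries the exact operator norm of the derivative; only the quadratic remainder
    is estimated crudely. *)
Lemma increment_bound m n (T : R[i]^o -> 'M[R[i]]_(m, n)) U lam :
  analytic_on T U -> U lam ->
  exists2 C : R, 0 <= C & exists2 d : R, 0 < d &
    forall mu, cmod (mu - lam) < d -> forall w,
      norm2 ((T mu - T lam) *m w)
        <= (mxnorm2 (derive1 T lam) * cmod (mu - lam)
            + C * cmod (mu - lam) ^+ 2) * norm2 w.
Proof.
move=> anT Ulam; have [C C0 [d d0 TC]] := analytic_remainder anT Ulam.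
exists ((m * n)%:R * C); first by rewrite mulr_ge0.
exists d => // mu mud w; have {}TC := norm2_mulmx_le w (TC mu mud).
set D := derive1 T lam in TC *.
have -> : T mu - T lam
    = ((mu - lam) : R[i]) *: D + (T mu - T lam - ((mu - lam) : R[i]) *: D).
  by rewrite [RHS]addrC subrK.
rewrite mulmxDl -scalemxAl; apply: le_trans (norm2D _ _) _.
rewrite mulrDl lerD //; last by rewrite -[_ * C * _]mulrA.
by rewrite norm2Z [leRHS]mulrAC [leRHS]mulrC ler_wpM2l ?cmod_ge0 // norm2_mulmx.
Qed.

(** If the derivative of [T] vanished, [T z *m x] would be quadratically small, hence so would
    [\det (T z)] by the adjugate bound, and the root would not be simple. *)
Lemma derive_at_simple_root_neq0 n (T : R[i]^o -> 'M[R[i]]_n) U lam x :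
  analytic_on T U -> U lam -> simple_root (fun z => \det (T z)) lam ->
  T lam *m x = 0 -> norm2 x = 1 -> 0 < mxnorm2 (derive1 T lam).
Proof.
move=> anT Ulam [det0 ddet] Tx x1.
rewrite lt_neqAle mxnorm2_ge0 andbT eq_sym.
apply: contra ddet => /eqP t0; apply/eqP.
have [C C0 [d d0 TC]] := increment_bound anT Ulam.
(* Bounds every entry of [T z] once [cmod (z - lam) < 1], where the increment is at most [C]. *)
pose M := \sum_i \sum_j cmod (T lam i j) + C.
have S0 i : 0 <= \sum_j cmod (T lam i j) by rewrite sumr_ge0 // => j _; exact: cmod_ge0.
have M0 : 0 <= M by rewrite addr_ge0 // sumr_ge0.
have [K K0 detK] := det_mul_norm2_le n M0.
pose e := Num.min d 1.
have e0 : 0 < e by rewrite lt_min d0 ltr01.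
apply: (@derive1_quadratic_remainder _ _ _ _ _ (K * C)%:C%C e%:C%C).
  by rewrite ltcR.
move=> z; rewrite det0 !subr0 scaler0 subr0 -[X in X < _]cmodE ltcR lt_min.
move=> /andP[zd z1]; have {}TC := TC z zd; rewrite t0 mul0r add0r in TC.
have TM i j : cmod (T z i j) <= M.
  rewrite -[T z i j](subrK (T lam i j)); apply: le_trans (cmodD _ _) _.
  rewrite addrC lerD //.
    by rewrite (bigD1 i) //= (bigD1 j) //= -addrA lerDl addr_ge0 // sumr_ge0 //
      => l _; exact: cmod_ge0.
  have := TC (delta_mx j 0).
  have -> : norm2 (delta_mx j 0 : 'cV[R[i]]_n) = 1.
    rewrite /norm2 (bigD1 j) //= mxE !eqxx /cmod normr1 expr1n big1 ?addr0 ?sqrtr1 //.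
    by move=> k kj; rewrite mxE (negbTE kj) normr0 expr0n.
  rewrite mulr1 -colE => TCj; apply: le_trans (_ : C * cmod (z - lam) ^+ 2 <= _).
    by apply: le_trans TCj; apply: le_trans (cmod_le_norm2 _ i); rewrite !mxE.
  by rewrite ler_piMr // exprn_ile1 ?cmod_ge0 // ltW.
have := detK _ x TM; rewrite x1 mulr1 => detz.
rewrite -cmodE -[`|_ - _|]cmodE -rmorphXn -rmorphM lecR -mulrA.
apply: le_trans detz _; rewrite ler_pM2l //.
by have := TC x; rewrite mulmxBl Tx subr0 x1 mulr1.
Qed.

End LocalEstimate.

(** * Sine bounds near the eigenvalue, with [t] standing for the norm of the derivative *)

Section Perturbation.
Variables (R : realType) (n k : nat) (T : R[i]^o -> 'M[R[i]]_n) (lam : R[i]^o).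
Variables (x : 'cV[R[i]]_n) (X : 'M[R[i]]_(n, k)) (t C d : R).
Hypotheses (x1 : norm2 x = 1) (xX : orthonormal_basis_compl x X).
Hypotheses (Tx : T lam *m x = 0) (t_ge0 : 0 <= t) (C_ge0 : 0 <= C) (d_gt0 : 0 < d).
Hypothesis T_incr : forall mu, cmod (mu - lam) < d -> forall w,
  norm2 ((T mu - T lam) *m w)
    <= (t * cmod (mu - lam) + C * cmod (mu - lam) ^+ 2) * norm2 w.

Local Notation L mu := (X^t* *m T mu *m X).

Lemma residual_eigenvector mu : cmod (mu - lam) < d ->
  norm2 (T mu *m x) <= t * cmod (mu - lam) + C * cmod (mu - lam) ^+ 2.
Proof. by move=> /T_incr/(_ x); rewrite mulmxBl Tx subr0 x1 mulr1. Qed.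

Lemma compression_incr mu v : cmod (mu - lam) < d -> cmod (mu - lam) < 1 ->
  norm2 ((L mu - L lam) *m v) <= (t + C) * cmod (mu - lam) * norm2 v.
Proof.
move=> mud mu1.
have -> : (L mu - L lam) *m v = X^t* *m ((T mu - T lam) *m (X *m v)).
  by rewrite -mulmxBl -mulmxBr !mulmxA.
apply: le_trans (norm2_compl_le x1 xX _) _; apply: le_trans (T_incr mud _) _.
rewrite (norm2_compl_emb xX) ler_wpM2r ?norm2_ge0 // mulrDl lerD2l.
by rewrite ler_wpM2l // expr2 ler_piMr ?cmod_ge0 // ltW.
Qed.

(** If [M] bounds the inverse of [L lam], that matrix shrinks norms at most by [M^-1]. A
    perturbation below half of this leaves [(2 * M)^-1 <= sigma_min (L mu)], so dividing
    [C * h ^+ 2] costs at most a factor [2 * M]. *)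
Lemma sin_bound_nonsingular : L lam \in unitmx ->
  exists2 Q : R, 0 <= Q & exists2 e : R, 0 < e &
    forall mu v, cmod (mu - lam) < e -> norm2 v = 1 -> 0 < sigma_min (L mu) ->
      norm2 (X^t* *m v)
        <= (norm2 (T mu *m v) + t * cmod (mu - lam)) / sigma_min (L mu)
           + Q * cmod (mu - lam) ^+ 2.
Proof.
move=> L0u; have [M M0 invM] := mulmx_bounded (invmx (L lam)).
pose K := t + C; have K0 : 0 <= K by exact: addr_ge0.
have KM0 : 0 < 2 * M * (K + 1) by rewrite !mulr_gt0 // ltr_wpDl.
exists (C * (2 * M)); first by rewrite mulr_ge0 // mulr_ge0 // ltW.
(* The last radius ensures [K * h <= (2 * M)^-1]; [K + 1] replaces [K], which may be 0. *)
exists (Num.min (Num.min d 1) (2 * M * (K + 1))^-1).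
  by rewrite !lt_min d_gt0 ltr01 invr_gt0.
move=> mu v; rewrite !lt_min => /andP[/andP[mud mu1] muK] v1 s0.
set h := cmod (mu - lam) in mud mu1 muK *; set s := sigma_min (L mu) in s0 *.
have h0 : 0 <= h := cmod_ge0 _.
have Kh : K * h <= (2 * M)^-1.
  have : (K + 1) * h <= (2 * M)^-1.
    rewrite -ler_pdivlMl ?ltr_wpDl // -invfM.
    by rewrite [_ * (K + 1)]mulrC in muK; rewrite ltW.
  by apply: le_trans; rewrite ler_wpM2r // lerDl.
have sM : (2 * M)^-1 <= s.
  apply: le_sigma_min => // [|u]; first by rewrite invr_ge0 mulr_ge0 // ltW.
  have := invM (L lam *m u); rewrite mulmxA mulVmx // mul1mx => uM.
  have := norm2D (L mu *m u) (- ((L mu - L lam) *m u)).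
  rewrite norm2N -mulmxBl opprB addrC subrK => Lu.
  have := compression_incr u mud mu1; rewrite -/K -/h => incr.
  have {}incr := le_trans incr (ler_wpM2r (norm2_ge0 u) Kh).
  have {}Lu := le_trans Lu (lerD (lexx _) incr).
  have {}uM : M^-1 * norm2 u <= norm2 (L lam *m u) by rewrite ler_pdivrMl.
  have := le_trans uM Lu.
  have -> : M^-1 * norm2 u = (2 * M)^-1 * norm2 u + (2 * M)^-1 * norm2 u.
    by rewrite invfM; field; rewrite gt_eqF.
  by rewrite lerD2r.
have c0 := cmod_ge0 (cdot x v).
have c1 : cmod (cdot x v) <= 1.
  have := norm2_pythagoras x1 xX v; rewrite v1 expr1n => E.
  rewrite -(ler_pXn2r (n := 2)) ?nnegrE //.
  by rewrite expr1n E lerDl sqr_ge0.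
have res := residual_bound x1 xX (T mu) v; rewrite -/s in res.
have tau := residual_eigenvector mud; rewrite -/h in tau.
have {}res : s * norm2 (X^t* *m v) <= norm2 (T mu *m v) + t * h + C * h ^+ 2.
  apply: le_trans res _; rewrite -addrA lerD2l.
  by apply: le_trans tau; rewrite ler_piMr ?norm2_ge0.
rewrite mulrC -ler_pdivlMr // in res; apply: le_trans res _.
rewrite [leLHS]mulrDl lerD2l mulrAC ler_wpM2r ?sqr_ge0 // ler_wpM2l //.
by rewrite -[leRHS]invrK lef_pV2 // posrE ?invr_gt0 ?mulr_gt0.
Qed.

(* Here [sigma_min (L mu)] is at most [K |mu - lam|] with [K = t + C]. The bound
   is then immediate if [norm2 (X^t* *m v) <= t / K]; otherwise the cosine
   [cmod (cdot x v)] stays away from 1, which absorbs the quadratic term. *)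
Lemma sin_bound_singular : 0 < t -> L lam \notin unitmx ->
  exists2 e : R, 0 < e &
    forall mu v, cmod (mu - lam) < e -> norm2 v = 1 -> 0 < sigma_min (L mu) ->
      norm2 (X^t* *m v)
        <= (norm2 (T mu *m v) + t * cmod (mu - lam)) / sigma_min (L mu).
Proof.
move=> t0 L0u; pose K := t + C; have K0 : 0 < K by rewrite ltr_pwDl.
have [u u0 Lu] : exists2 u, 0 < norm2 u & L lam *m u = 0.
  have : kermx (L lam)^T != 0 by rewrite kermx_eq0 row_free_unit unitmx_tr.
  move=> /rowV0Pn[w /sub_kermxP wL w0]; exists w^T.
    by rewrite lt_neqAle norm2_ge0 andbT eq_sym norm2_eq0 trmx_eq0.
  by apply: trmx_inj; rewrite trmx_mul trmxK wL trmx0.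
(* If [a > t / K], then [c ^+ 2 = 1 - a ^+ 2] and [c <= (1 + c ^+ 2) / 2] give [c <= 1 - eta]. The
   radius below yields [C * h <= t * eta]. *)
pose eta := (t / K) ^+ 2 / 2.
have eta0 : 0 < eta by rewrite !(divr_gt0, exprn_gt0).
have C1 : 0 < C + 1 by rewrite ltr_wpDl.
exists (Num.min (Num.min d 1) (t * eta / (C + 1))).
  by rewrite !lt_min d_gt0 ltr01 divr_gt0 // mulr_gt0.
move=> mu v; rewrite !lt_min => /andP[/andP[mud mu1] muK] v1 s0.
set h := cmod (mu - lam) in mud mu1 muK *; set s := sigma_min (L mu) in s0 *.
have h0 : 0 <= h := cmod_ge0 _.
have Ch : C * h <= t * eta.
  rewrite ltr_pdivlMr // in muK; apply: le_trans (ltW muK).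
  by rewrite mulrC ler_wpM2l // lerDl.
(* Test [L mu] on the null vector [u] of [L lam]: only the increment survives. *)
have sK : s <= K * h.
  rewrite -(ler_pM2r u0); apply: le_trans (sigma_min_le _ _) _.
  by have := compression_incr u mud mu1; rewrite mulmxBl Lu subr0.
have res := residual_bound x1 xX (T mu) v; rewrite -/s in res.
have tau := residual_eigenvector mud; rewrite -/h in tau.
have := norm2_pythagoras x1 xX v; rewrite v1 expr1n => E.
have c0 := cmod_ge0 (cdot x v).
move: (cmod (cdot x v)) (norm2 (X^t* *m v)) (norm2_ge0 (X^t* *m v)) E c0 res.
move: (norm2 (T mu *m v)) (norm2_ge0 (T mu *m v)) tau.
move=> rho rho0 tau c a a0 E c0 res.
rewrite ler_pdivlMr // mulrC.
have [aK|aK] := lerP (K * a) t.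
  apply: (le_trans (ler_wpM2r a0 sK)); rewrite mulrAC.
  by apply: (le_trans (ler_wpM2r h0 aK)); rewrite lerDr.
apply: le_trans res _; rewrite lerD2l.
have c_eta : c <= 1 - eta.
  have : (t / K) ^+ 2 <= a ^+ 2.
    rewrite ler_pXn2r ?nnegrE ?divr_ge0 ?(ltW K0) //.
    by rewrite ler_pdivrMr // mulrC ltW.
  have := sqr_ge0 (1 - c); rewrite /eta; move: ((t / K) ^+ 2) => y.
  by lra.
have th : 0 <= t * h + C * h ^+ 2 by rewrite addr_ge0 // mulr_ge0 // sqr_ge0.
apply: (le_trans (ler_wpM2r c0 tau)); apply: (le_trans (ler_wpM2l th c_eta)).
(* In [(t * h + C * h ^+ 2) * (1 - eta)] the loss [eta * t * h] outweighs [C * h ^+ 2], leaving at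
   most [t * h]. *)
have := ler_wpM2r h0 Ch; have : 0 <= C * h ^+ 2 * eta.
  by apply: mulr_ge0; [rewrite mulr_ge0 ?sqr_ge0|exact: ltW].
rewrite !expr2; lra.
Qed.

End Perturbation.

Theorem theorem3p1 (R : realType) (n : nat) (Omega : set R[i]^o)
    (T : R[i]^o -> 'M[R[i]]_n.+1) (lam : R[i]^o) (x : 'cV[R[i]]_n.+1)
    (Xp : 'M[R[i]]_(n.+1, n)) (r : R) :
  open Omega -> connected Omega ->
  analytic_on T Omega -> regular_on T Omega ->
  Omega lam -> simple_root (fun z => \det (T z)) lam ->
  T lam *m x = 0 -> norm2 x = 1 ->
  orthonormal_basis_compl x Xp ->
  0 < r -> closed_disc lam r `<=` Omega ->
  exists2 E : R[i]^o -> R,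
    E =O_ (nbhs lam) (fun mu => cmod (mu - lam) ^+ 2) &
    forall (mu : R[i]^o) (xt : 'cV[R[i]]_n.+1),
      closed_disc lam r mu -> norm2 xt = 1 ->
      let rho := norm2 (T mu *m xt) in
      let L := Xp^t* *m T mu *m Xp in
      0 < sigma_min L ->
      sin (line_angle xt x) <=
        (rho + mxnorm2 (derive1 T lam) * cmod (mu - lam)) / sigma_min L
        + E mu.
Proof.
move=> _ _ anT _ Olam root_lam Tx x1 xX _ _.
have t0 := derive_at_simple_root_neq0 anT Olam root_lam Tx x1.
have [C C0 [d d0 Tinc]] := increment_bound anT Olam.
have [Q Q0 [e e0 near_bound]] : exists2 Q : R, 0 <= Q & exists2 e : R, 0 < e &
    forall mu v, cmod (mu - lam) < e -> norm2 v = 1 ->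
      0 < sigma_min (Xp^t* *m T mu *m Xp) ->
      norm2 (Xp^t* *m v)
        <= (norm2 (T mu *m v) + mxnorm2 (derive1 T lam) * cmod (mu - lam))
             / sigma_min (Xp^t* *m T mu *m Xp)
           + Q * cmod (mu - lam) ^+ 2.
  (* Both cases give a radius and a constant independent of [mu] and [v]; the singular one allows
     [Q = 0]. *)
  have [L0|L0] := boolP (Xp^t* *m T lam *m Xp \in unitmx).
    exact: (sin_bound_nonsingular x1 xX Tx (ltW t0) C0 d0 Tinc).
  have [e e0 bnd] := sin_bound_singular x1 xX Tx (ltW t0) C0 d0 Tinc t0 L0.
  exists 0 => //; exists e => // mu v mue v1 s0.
  by rewrite mul0r addr0; exact: bnd.
(* The error must be defined on the whole disc: beyond radius [e] the value 1 suffices, because the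
   sine is at most 1 and the quotient is nonnegative. Only the values near [lam] matter for the
   order. *)
exists (fun mu => if cmod (mu - lam) < e then Q * cmod (mu - lam) ^+ 2 else 1).
  apply/eqO_exP; exists (Q + 1); first by rewrite ltr_wpDl.
  apply/nbhs_ballP; exists e%:C%C => [|mu]; first by rewrite /= ltcR.
  rewrite -ball_normE /ball_ /= distrC -cmodE ltcR => mue; rewrite mue.
  by rewrite normrM (ger0_norm Q0) ler_wpM2r // lerDl.
move=> mu xt _ xt1 rho L s0; rewrite (sin_line_angle x1 xX) //.
case: ifP => mue; first exact: near_bound.
apply: le_trans (norm2_compl_le x1 xX xt) _; rewrite xt1 lerDr divr_ge0 ?(ltW s0) //.
by rewrite addr_ge0 ?norm2_ge0 // mulr_ge0 ?cmod_ge0 // ltW.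
Qed.
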